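(* Let $(n_k)_{k\in\mathbb{N}}$ and $(m_k)_{k\in\mathbb{N}}$ be two sequences of positive integers with $m_k \geq n_k/2$ for every $k\in\mathbb{N}$. Let $Q\in\mathbb{R}[x]$ be a polynomial. Let $\{f_k:\mathbb{Z}_{n_k}\to\mathbb{C}\}_{k\in\mathbb{N}}$ be a concentrated family of functions such that $\|f_k\|_2^2\leq Q(\log(n_k))$ for all $k\in\mathbb{N}$. Then the family $\{\widetilde{f_k}:\mathbb{Z}_{m_k}\to\mathbb{C}\}_{k\in\mathbb{N}}$ is concentrated.
   Context: $\mathbb{Z}_n=\{0,1,\dots,n-1\}$ with addition mod $n$. For $f,g:\mathbb{Z}_n\to\mathbb{C}$, $\langle f,g\rangle=\frac1n\sum_{x\in\mathbb{Z}_n}f(x)\overline{g(x)}$ and $\|f\|_2^2=\langle f,f\rangle$. For $\alpha\in\mathbb{Z}_n$, $\chi_\alpha(x)=\chi_{\alpha,n}(x)=\exp(2\pi i\alpha x/n)$ and $\widehat f(\alpha)=\langle f,\chi_\alpha\rangle$, so $f=\sum_{\alpha}\widehat f(\alpha)\chi_\alpha$. For $\Gamma\subseteq\mathbb{Z}_n$, $f|_\Gamma:\mathbb{Z}_n\to\mathbb{C}$ denotes the projection $f|_\Gamma(x)=\sum_{\alpha\in\Gamma}\widehat f(\alpha)\chi_\alpha(x)$. For $f:\mathbb{Z}_n\to\mathbb{C}$ and $m\in\mathbb{N}$, $\widetilde f:\mathbb{Z}_m\to\mathbb{C}$ is defined by $\widetilde f(x)=f(x)$ for $0\le x<\min(n,m)$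 and $\widetilde f(x)=0$ otherwise. A family $\{f_k:\mathbb{Z}_{n_k}\to\mathbb{C}\}_{k\in\mathbb{N}}$ (with $n_k$ positive integers) is concentrated if there is a bivariate polynomial $P\in\mathbb{R}[x,y]$ such that for all $k\in\mathbb{N}$ and all $\epsilon>0$ there is a set $\Gamma_k\subseteq\mathbb{Z}_{n_k}$ with $|\Gamma_k|\le P(\log(n_k),1/\epsilon)$ and $\|f_k-f_k|_{\Gamma_k}\|_2^2<\epsilon$. *)

(* Defs.v *)
From mathcomp Require Import all_boot all_order all_algebra.
From mathcomp Require Import all_classical all_reals all_analysis.
From mathcomp Require Import complex.
Set Implicit Arguments. Unset Strict Implicit. Unset Printing Implicit Defensive.
Import Order.TTheory GRing.Theory Num.Theory.
Local Open Scope ring_scope.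
Local Open Scope complex_scope.

(* Z_n is represented by 'I_n (n > 0); only characters are needed. *)

Definition chi (R : realType) (n : nat) (a x : 'I_n) : R[i] :=
  let t : R := 2 * pi * (a%:R * x%:R) / n%:R in (cos t) +i* (sin t).

Definition sqnormc (R : realType) (z : R[i]) : R := complex.Re z ^+ 2 + complex.Im z ^+ 2.

Definition l2sq (R : realType) (n : nat) (f : 'I_n -> R[i]) : R :=
  n%:R^-1 * \sum_(x < n) sqnormc (f x).

Definition fourier (R : realType) (n : nat) (f : 'I_n -> R[i]) (a : 'I_n) : R[i] :=
  (n%:R^-1)%:C * \sum_(x < n) f x * conjc (chi R a x).

Definition proj (R : realType) (n : nat) (f : 'I_n -> R[i]) (G : {set 'I_n})
  : 'I_n -> R[i] :=
  fun x => \sum_(a in G) fourier f a * chi R a x.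

Definition extend (R : realType) (n m : nat) (f : 'I_n -> R[i]) : 'I_m -> R[i] :=
  fun x => oapp f 0 (insub (val x)).

(* Bivariate P(x,y) in R[x,y] is P : {poly {poly R}}, outer variable y,
   inner variable x; P(a,b) = (P.[b%:P]).[a]. *)
Definition concentrated (R : realType) (n : nat -> nat)
  (f : forall k, 'I_(n k) -> R[i]) : Prop :=
  exists P : {poly {poly R}}, forall (k : nat) (eps : R), 0 < eps ->
    exists G : {set 'I_(n k)},
      (#|G|%:R <= (P.[(eps^-1)%:P]).[ln (n k)%:R]) /\
      l2sq (fun x => f k x - proj (f k) G x) < eps.

(* Main.v *)
(** Split f = g + h with g the projection of f to the few frequencies of G.  The extension of
    h to Z_m stays small because n <= 2m.  The extension of a single character chi_a of Z_n is a
    truncated character of Z_m with the (possibly fractional) frequency t = a m / n: summing a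
    geometric progression, its Fourier coefficient at b is O(1 / dist(b, t + mZ)), so discarding
    the O(K) frequencies within distance K of t + mZ loses only O(1 / K).  By Parseval it suffices
    to take the union of these windows over a in G, with K polynomial in log m and 1 / eps. *)
Require Import Defs.
From mathcomp Require Import all_boot all_order all_algebra.
From mathcomp Require Import all_classical all_reals all_analysis.
From mathcomp Require Import complex.
From mathcomp Require Import ring lra zify.
Import Order.TTheory GRing.Theory Num.Theory.
Import numFieldNormedType.Exports.
Local Open Scope ring_scope.
Local Open Scope complex_scope.

(** * Monotone majorants of polynomials on nonnegative arguments *)

Section PolyBounds.
Variable R : realFieldType.
Implicit Types (x y : R).

(** A polynomial need not be monotone. A bound of the form [C * (1 + x) ^+ N] is, so that log n can
    later be replaced by a larger quantity in log m. *)
Lemma horner_bound (p : {poly R}) :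
  exists C N, 0 <= C /\ forall x, 0 <= x -> p.[x] <= C * (1 + x) ^+ N.
Proof.
elim/poly_ind: p => [|p c [C [N [C0 hp]]]].
  by exists 0, 0%N; split => // x _; rewrite horner0 mul0r.
exists (C + `|c|), N.+1; split => [|x x0]; first by rewrite addr_ge0.
rewrite hornerMXaddC mulrDl; apply: lerD.
  have X0 : 0 <= C * (1 + x) ^+ N by rewrite mulr_ge0 // exprn_ge0 // addr_ge0.
  by have := hp x x0; rewrite exprSr mulrA; nra.
apply: le_trans (ler_norm c) _; rewrite ler_peMr //.
by rewrite exprn_ege1 // lerDl.
Qed.

(** Both variables enter through one product that is at least 1, so powers can be raised to a common
    exponent and a single majorant of the product suffices later. *)
Lemma horner2_bound (P : {poly {poly R}}) :
  exists C N, 0 <= C /\ forall x y, 0 <= x -> 0 <= y ->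
    (P.[y%:P]).[x] <= C * ((1 + x) * (1 + y)) ^+ N.
Proof.
elim/poly_ind: P => [|P c [C [N [C0 hP]]]].
  by exists 0, 0%N; split => // x y _ _; rewrite !horner0 mul0r.
have [C' [N' [C'0 hc]]] := horner_bound c.
exists (C + C'), (maxn N.+1 N'); split => [|x y x0 y0]; first by rewrite addr_ge0.
set X := (1 + x) * (1 + y).
have X1 : 1 <= X by rewrite /X; nra.
have Xx : 1 + x <= X by rewrite /X; nra.
have yX : y <= X by rewrite /X; nra.
have X0 := le_trans ler01 X1.
rewrite hornerMXaddC hornerD hornerM hornerC mulrDl; apply: lerD.
  apply: (@le_trans _ _ (C * X ^+ N.+1)); last first.
    by apply: ler_wpM2l => //; apply: ler_weXn2l => //; rewrite leq_maxl.
  have Z0 : 0 <= C * X ^+ N by rewrite mulr_ge0 // exprn_ge0.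
  by have := hP x y x0 y0; rewrite exprSr mulrA -/X; nra.
apply: le_trans (hc x x0) _; apply: ler_wpM2l => //.
apply: (@le_trans _ _ (X ^+ N')).
  by apply: lerXn2r; rewrite // nnegrE ?addr_ge0.
by apply: ler_weXn2l => //; rewrite leq_maxr.
Qed.
End PolyBounds.

(** * Integers near a real point, and inverse-square sums over those far from it *)

Section Tails.
Variable R : realFieldType.
Implicit Types (s K x y : R).

Lemma sum_right_tail_le s K (M : nat) : 1 <= K ->
  \sum_(b < M | K < b%:R - s) (b%:R - s) ^- 2 <= 2 / K.
Proof.
move=> K1; have K0 : 0 < K := lt_le_trans ltr01 K1.
(* The induction on [M] needs the remainder of the telescoping sum. While [M - s <= K] the sum is
   empty, whence the value 0. *)
suff h : \sum_(b < M | K < b%:R - s) (b%:R - s) ^- 2 <=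
    if K < M%:R - s then 2 / K - 2 / (M%:R - s) else 0.
  apply: (le_trans h); case: ifP => [KM|_]; last by rewrite divr_ge0 ?ltW.
  by rewrite gerBl divr_ge0 ?ltW ?(lt_trans K0 KM).
(* For y >= 1, y^-2 <= 2 / y - 2 / (y + 1), which telescopes. *)
elim: M => [|M IH].
  rewrite big_ord0; case: ifP => // KM; rewrite subr_ge0.
  rewrite ler_pM2l // lef_pV2 ?posrE ?(lt_trans K0 KM) //; exact: ltW.
rewrite big_mkcond big_ord_recr -big_mkcond /=.
have -> : M.+1%:R - s = (M%:R - s) + 1 :> R by rewrite -natr1; ring.
move: IH; move: (M%:R - s) (\sum_(_ < _ | _) _) => y S.
case: (ltP K y) => Ky hS.
  have y0 := lt_trans K0 Ky.
  rewrite (lt_trans Ky) ?ltrDl //.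
  apply: (le_trans (lerD hS (lexx _))).
  rewrite -addrA lerD2l -subr_ge0.
  have -> : - (2 / (y + 1)) - (- (2 / y) + y ^- 2) =
     (y - 1) / (y ^+ 2 * (y + 1)).
    by field; rewrite !lt0r_neq0 ?addr_gt0.
  by rewrite divr_ge0 ?mulr_ge0 ?sqr_ge0 ?subr_ge0 ?addr_ge0 ?ltW // (le_lt_trans K1).
rewrite addr0; apply: (le_trans hS); case: ifP => // Ky1.
by rewrite subr_ge0 ler_pM2l // lef_pV2 ?posrE ?(lt_trans K0 Ky1) //; exact: ltW.
Qed.

Lemma card_right_near_le s K (M : nat) : 0 <= K ->
  #|[set b : 'I_M | (0 <= b%:R - s <= K)]|%:R <= K + 2.
Proof.
move=> K0; rewrite cardsE -sum1_card natr_sum.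
(* At most [M - s + 1] integers lie in [s, M). A new one is counted only when [M - s <= K], and then
   the new count is at most [M - s + 2 <= K + 2]. *)
suff h : \sum_(b < M | 0 <= b%:R - s <= K) (1 : R) <=
    if M%:R - s < 0 then 0 else Num.min (K + 2) (M%:R - s + 1).
  apply: (le_trans h); case: ifP => _; first by lra.
  by rewrite ge_min lexx.
elim: M => [|M IH].
  rewrite big_ord0; case: ltP => // h; rewrite le_min; apply/andP; split; lra.
rewrite big_mkcond big_ord_recr -big_mkcond /=.
have -> : M.+1%:R - s = (M%:R - s) + 1 :> R by rewrite -natr1; ring.
move: IH; move: (M%:R - s) (\sum_(_ < _ | _) _) => y S.
by case: (ltP y 0) => y0; case: (ltP (y + 1) 0) => y1; case: (leP y K) => yK /=;
  rewrite ?addr0 ?le_min => ?; try (apply/andP; split); lra.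
Qed.

(** The reflection of {0, ..., M-1} turns points left of [s] into points right of [M - 1 - s], so
    one-sided estimates yield two-sided ones. *)
Lemma rev_ord_sub (M : nat) s (b : 'I_M) :
  (rev_ord b)%:R - (M%:R - 1 - s) = s - b%:R :> R.
Proof.
have -> : M%:R = (rev_ord b)%:R + b%:R + 1 :> R.
  by rewrite -natrD natr1; congr (_%:R); rewrite /=; have := ltn_ord b; lia.
by ring.
Qed.

Lemma sum_tail_le s K (M : nat) : 1 <= K ->
  \sum_(b < M | K < `|b%:R - s|) (b%:R - s) ^- 2 <= 4 / K.
Proof.
move=> K1; have K0 : 0 < K := lt_le_trans ltr01 K1.
have -> : 4 / K = 2 / K + 2 / K by field; rewrite lt0r_neq0.
apply: le_trans (lerD (sum_right_tail_le s K M K1)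
  (sum_right_tail_le (M%:R - 1 - s) K M K1)).
rewrite [X in _ + X](reindex_inj rev_ord_inj) /=.
rewrite big_mkcond [X in X + _]big_mkcond [X in _ + X]big_mkcond -big_split /=.
apply: ler_sum => b _; rewrite rev_ord_sub.
have p : 0 <= (b%:R - s) ^- 2 by rewrite invr_ge0 sqr_ge0.
have -> : (s - b%:R) ^- 2 = (b%:R - s) ^- 2 by rewrite -(opprB s) sqrrN.
case: ltrP => [|_]; last by rewrite addr_ge0 //; case: ifP.
rewrite ltr_normr opprB => /orP[->|->].
  by rewrite lerDl; case: ifP.
by rewrite lerDr; case: ifP.
Qed.

Lemma card_near_le s K (M : nat) : 0 <= K ->
  #|[set b : 'I_M | `|b%:R - s| <= K]|%:R <= 2 * K + 4.
Proof.
move=> K0; have -> : 2 * K + 4 = (K + 2) + (K + 2) by ring.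
apply: le_trans (lerD (card_right_near_le s K M K0)
  (card_right_near_le (M%:R - 1 - s) K M K0)).
rewrite -(card_imset [set b : 'I_M | 0 <= b%:R - (M%:R - 1 - s) <= K]
  (@rev_ord_inj M)) -natrD ler_nat.
apply: leq_trans (leq_card_setU _ _); apply: subset_leq_card.
apply/fintype.subsetP => b; rewrite !inE.
case: (lerP 0 (b%:R - s)) => h1; first by rewrite ger0_norm // => ->.
rewrite ltr0_norm // => h2.
apply/orP; right; apply/imsetP; exists (rev_ord b); last by rewrite rev_ordK.
by rewrite inE rev_ord_sub; apply/andP; split; lra.
Qed.

End Tails.

(** * Squared moduli, points of the unit circle and geometric sums *)

Section Characters.
Variable R : realType.
Implicit Types (t u s : R) (z w : R[i]).

Lemma sqnormcE z : (sqnormc z)%:C = z * conjc z.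
Proof. by rewrite -sqr_normc -add_Re2_Im2. Qed.

Lemma sqnormc_ge0 z : 0 <= sqnormc z.
Proof. by rewrite addr_ge0 ?sqr_ge0. Qed.

Lemma sqnormc0 : sqnormc (0 : R[i]) = 0.
Proof. by rewrite /sqnormc /= expr0n addr0. Qed.

Lemma sqnormcM z w : sqnormc (z * w) = sqnormc z * sqnormc w.
Proof. by case: z w => [a b] [c d]; rewrite /sqnormc /=; ring. Qed.

Lemma sqnormc_real t : sqnormc t%:C = t ^+ 2.
Proof. by rewrite /sqnormc /= expr0n addr0. Qed.

Lemma sqnormcD_le z w : sqnormc (z + w) <= 2 * sqnormc z + 2 * sqnormc w.
Proof.
case: z w => [a b] [c d]; rewrite /sqnormc /=.
by have := sqr_ge0 (a - c); have := sqr_ge0 (b - d); nra.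
Qed.

(** Cauchy-Schwarz against the constant 1, applied to real and imaginary parts. *)
Lemma sqnormc_sum_le (I : finType) (A : {set I}) (z : I -> R[i]) :
  sqnormc (\sum_(i in A) z i) <= #|A|%:R * \sum_(i in A) sqnormc (z i).
Proof.
have sq_sum (x : I -> R) :
    (\sum_(i in A) x i) ^+ 2 <= #|A|%:R * \sum_(i in A) x i ^+ 2.
  have [->|An0] := eqVneq A finset.set0.
    by rewrite !big_set0 expr0n mulr0.
  have A0 : 0 < #|A|%:R :> R by rewrite ltr0n card_gt0.
  set S := \sum_(i in A) x i.
  (* Nonnegativity of the variance: this sum equals |A| (|A| sum x_i^2 - S^2). *)
  have : 0 <= \sum_(i in A) (#|A|%:R * x i - S) ^+ 2.
    by apply: sumr_ge0 => i _; exact: sqr_ge0.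
  have expand i : (#|A|%:R * x i - S) ^+ 2 =
      #|A|%:R ^+ 2 * x i ^+ 2 + (- 2 * #|A|%:R * S) * x i + S ^+ 2 by ring.
  under eq_bigr => i _ do rewrite expand.
  rewrite 2!big_split /= sumr_const -!mulr_sumr -/S -mulr_natl => h.
  rewrite -subr_ge0 -(pmulr_rge0 _ A0); move: h.
  by congr (0 <= _); ring.
have ReIm : \sum_(i in A) z i =
    (\sum_(i in A) complex.Re (z i)) +i* (\sum_(i in A) complex.Im (z i)).
  rewrite -[RHS]/(Complex _ _).
  elim/big_rec3: _ => [//|i a b c _ ->].
  by case: (z i).
rewrite ReIm /sqnormc /= big_split /= mulrDr.
by apply: lerD; exact: sq_sum.
Qed.

Definition cis t : R[i] := cos t +i* sin t.

Lemma cis0 : cis 0 = 1.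
Proof. by rewrite /cis cos0 sin0. Qed.

Lemma cisD s t : cis (s + t) = cis s * cis t.
Proof. by rewrite /cis cosD sinD; congr (_ +i* _); ring. Qed.

Lemma cisN t : cis (- t) = conjc (cis t).
Proof. by rewrite /cis cosN sinN. Qed.

Lemma cis_mulrn t k : cis (t *+ k) = cis t ^+ k.
Proof. by elim: k => [|k IH]; rewrite ?mulr0n ?cis0 // mulrS cisD IH exprS. Qed.

Lemma cis_2pi_nat (k : nat) : cis (2 * pi * k%:R) = 1.
Proof.
have -> : 2 * pi * k%:R = (pi *+ 2) *+ k :> R.
  by rewrite -[RHS]mulr_natr; congr (_ * _); rewrite mulr_natl.
by rewrite cis_mulrn /cis cos2pi sin2pi expr1n.
Qed.

Lemma sqnormc_cis t : sqnormc (cis t) = 1.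
Proof. by rewrite /sqnormc /= cos2Dsin2. Qed.

Lemma sqnormc_cis_sub1 t : sqnormc (cis (2 * t) - 1) = 4 * sin t ^+ 2.
Proof.
rewrite /sqnormc /= mulr2n mulrDl mul1r cosD sinD.
have := cos2Dsin2 t; move: (cos t) (sin t) => c s.
move=> h; have -> : s ^+ 2 = 1 - c ^+ 2 by rewrite -h; ring.
have e : s * s = 1 - c ^+ 2 by rewrite -h; ring.
rewrite subr0 e.
have -> : (s * c + c * s) ^+ 2 = 4 * c ^+ 2 * (s * s) by ring.
by rewrite e; ring.
Qed.

(** A weak Jordan inequality. If cos t <= 1/2, then sin t >= 1/2 >= t/4 because pi/2 <= 2. Otherwise
    the mean value theorem gives sin t = t cos c with cos c >= cos t > 1/2. *)
Lemma sin_ge_quarter t : 0 <= t <= pi / 2 -> t / 4 <= sin t.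
Proof.
move=> /andP[t0 tpi].
case: (eqVneq t 0) => [e|tn0]; first by rewrite e mul0r sin0.
have {}t0 : 0 < t by rewrite lt_def tn0.
have /andP[_ pi2] := (pihalf_02_cos_pihalf R).1.
have c0 : 0 <= cos t by apply: cos_ge0_pihalf; apply/andP; split; lra.
have s0 : 0 <= sin t by apply: sin_ge0_pi; apply/andP; split; lra.
have cs := cos2Dsin2 t.
have [ct|ct] := leP (cos t) (1 / 2); first by nra.
have cont : {within `[0, t], continuous (@sin R)}%classic.
  by apply: continuous_subspaceT => x; exact: continuous_sin.
have [c /andP[c0' ct']] :=
  @MVT_segment R sin cos 0 t (ltW t0) (fun x _ => is_derive_sin x) cont.
rewrite sin0 !subr0 => ->.
suff : cos t <= cos c by nra.
have [e|cnt] := eqVneq c t; first by rewrite e.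
apply/ltW; move: c0' ct'; rewrite !bnd_simp => c0' ct'.
rewrite ltr_cos ?lt_neqAle ?cnt //; rewrite in_itv /=; apply/andP; split; lra.
Qed.

(** The minimum is the distance from [u] to the nearest integer. The symmetry of the sine under u ->
    1 - u reduces to [0, 1/2], where the previous bound and pi >= 2 apply. *)
Lemma sin_pi_sq_ge u : `|u| <= 1 ->
  Num.min `|u| (1 - `|u|) ^+ 2 <= 4 * sin (pi * u) ^+ 2.
Proof.
move=> u1.
have -> : sin (pi * u) ^+ 2 = sin (pi * `|u|) ^+ 2.
  by case: (ger0P u) => // _; rewrite mulrN sinN sqrrN.
move: (normr_ge0 u) u1; move: `|u| => {}u u0 u1.
have pi2 := pi_ge2 R.
have half (v : R) : 0 <= v <= 1 / 2 -> v / 2 <= sin (pi * v).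
  move=> /andP[v0 v1]; have := @sin_ge_quarter (pi * v) _.
  have : 0 <= pi * v <= pi / 2 by apply/andP; split; nra.
  by move=> h /(_ h); nra.
have [uh|uh] := leP u (1 - u).
  have := half u; have : 0 <= u <= 1/2 by apply/andP; split; lra.
  by move=> h /(_ h); nra.
have := half (1 - u); have : 0 <= 1 - u <= 1/2 by apply/andP; split; lra.
have -> : sin (pi * (1 - u)) = sin (pi * u).
  by rewrite mulrBr mulr1 sinB sinpi cospi; ring.
by move=> h /(_ h); nra.
Qed.

(** With w the ratio, S (w - 1) = w^L - 1 bounds |S| by 2 / |w - 1| whatever [L] is, and |w - 1| is
    at least the distance from d / M to the integers. The minimum over the translates of [d] by 0, M
    and -M is traded for a sum of three terms, each summable on its own. *)
Lemma sqnormc_geom_cis_le (L : nat) (M d : R) : 0 < `|d| < M ->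
  M ^- 2 * sqnormc (\sum_(x < L) cis (2 * pi * (d / M)) ^+ x)
  <= 4 * (d ^- 2 + (M - d) ^- 2 + (M + d) ^- 2).
Proof.
case/andP=> d0 dM; have M0 := lt_trans d0 dM.
set u := d / M; set w := cis _; set S := \sum_(x < L) _.
have u1 : `|u| < 1 by rewrite normrM normfV (gtr0_norm M0) ltr_pdivrMr ?mul1r.
have u0 : 0 < `|u| by rewrite normrM normfV (gtr0_norm M0) divr_gt0.
have key : sqnormc S * (4 * sin (pi * u) ^+ 2) <= 4.
  rewrite -sqnormc_cis_sub1 mulrA -/w -sqnormcM.
  have -> : S * (w - 1) = w ^+ L - 1 by rewrite subrX1 mulrC.
  apply: (le_trans (sqnormcD_le _ _)).
  rewrite -cis_mulrn sqnormc_cis.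
  have -> : sqnormc (-1 : R[i]) = 1 by rewrite /sqnormc /= oppr0 expr0n addr0 sqrrN expr1n.
  by lra.
set v := Num.min `|u| (1 - `|u|).
have v0 : 0 < v by rewrite lt_min u0 subr_gt0.
have {}key : sqnormc S <= 4 / v ^+ 2.
  rewrite ler_pdivlMr ?exprn_gt0 //; apply: le_trans key.
  apply: ler_wpM2l; first exact: sqnormc_ge0.
  by apply: sin_pi_sq_ge; exact: ltW.
have -> : d ^- 2 = `|d| ^- 2 by rewrite real_normK ?num_real.
rewrite -(addrA (`|d| ^- 2)).
have -> : (M - d) ^- 2 + (M + d) ^- 2 = (M - `|d|) ^- 2 + (M + `|d|) ^- 2 :> R.
  by case: (ger0P d) => // _; rewrite addrC opprK.
apply: (@le_trans _ _ (M ^- 2 * (4 / v ^+ 2))).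
  by apply: ler_wpM2l key; rewrite invr_ge0 exprn_ge0 // ltW.
have -> : M ^- 2 * (4 / v ^+ 2) = 4 * ((M * v) ^- 2).
  by rewrite exprMn; field; rewrite !lt0r_neq0.
apply: ler_wpM2l; first by [].
have -> : M * v = Num.min `|d| (M - `|d|).
  rewrite /v minr_pMr ?ltW // mulrBr mulr1 /u normrM normfV (gtr0_norm M0).
  by rewrite mulrCA divff ?mulr1 ?lt0r_neq0.
have h (y : R) : 0 <= y ^- 2 by rewrite invr_ge0 sqr_ge0.
have := (h `|d|, h (M - `|d|), h (M + `|d|)) => -[[h1 h2] h3].
case: (leP `|d| (M - `|d|)) => _; rewrite -?addrA.
  by rewrite lerDl addr_ge0.
by rewrite addrCA lerDl addr_ge0.
Qed.

End Characters.

(** * Orthogonality of characters, Fourier inversion and Parseval *)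

Section Fourier.
Variable R : realType.
Implicit Types (s t K : R) (n m : nat).

Lemma cis_neq1 (M d : R) : 0 < `|d| < M -> cis R (2 * pi * (d / M)) != 1.
Proof.
case/andP=> d0 dM; have M0 := lt_trans d0 dM.
set u := d / M.
have u1 : `|u| < 1 by rewrite normrM normfV (gtr0_norm M0) ltr_pdivrMr ?mul1r.
have u0 : 0 < `|u| by rewrite normrM normfV (gtr0_norm M0) divr_gt0.
apply/eqP => w1.
have := sin_pi_sq_ge R u (ltW u1).
rewrite -sqnormc_cis_sub1 mulrA w1 subrr sqnormc0 leNgt exprn_gt0 //.
by rewrite lt_min u0 subr_gt0.
Qed.

(** Relative to modulus [M], the first factor has the possibly fractional frequency a M / N. The
    case [N = M] gives orthogonality; distinct moduli give the coefficients of extended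
    characters. *)
Lemma cis_mul_conj (N M a b : R) (x : nat) : N != 0 -> M != 0 ->
  cis R (2 * pi * (a * x%:R) / N) * conjc (cis R (2 * pi * (b * x%:R) / M)) =
  cis R (2 * pi * ((a * M / N - b) / M)) ^+ x.
Proof.
move=> N0 M0; rewrite -cisN -cisD -cis_mulrn -mulr_natr.
by congr (cis R _); field; rewrite N0 M0.
Qed.

Lemma chiC n (a x : 'I_n) : chi R a x = chi R x a.
Proof. by rewrite /chi (mulrC a%:R). Qed.

Lemma sum_chi_conj n (a b : 'I_n) :
  \sum_(x < n) chi R a x * conjc (chi R b x) = if a == b then n%:R else 0.
Proof.
have n0 : n%:R != 0 :> R by rewrite pnatr_eq0 -lt0n (leq_ltn_trans _ (ltn_ord a)).
under eq_bigr => x _ do rewrite (cis_mul_conj n%:R n%:R a%:R b%:R x n0 n0).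
rewrite mulfK //.
have [<-|ab] := eqVneq a b.
  rewrite subrr mul0r mulr0 cis0.
  by under eq_bigr => x _ do rewrite expr1n; rewrite sumr_const card_ord.
set w := cis _ _.
have w1 : w - 1 != 0.
  rewrite subr_eq0; apply: cis_neq1; rewrite normr_gt0 subr_eq0 eqr_nat.
  rewrite ab ltr_norml; have := (ltn_ord a, ltn_ord b) => -[].
  rewrite -!(ltr_nat R) => an bn.
  by have := ler0n R a; have := ler0n R b; move=> ? ?; apply/andP; split; lra.
(* Times [w - 1], the sum becomes [w ^+ n - 1], which is 0 because [a - b] is an integer. *)
apply: (mulIf w1); rewrite mul0r mulrC -subrX1 -cis_mulrn.
have -> : 2 * pi * ((a%:R - b%:R) / n%:R) *+ n =
    2 * pi * a%:R - 2 * pi * b%:R :> R by rewrite -[LHS]mulr_natr; field.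
by rewrite cisD cisN !cis_2pi_nat conjc1 mulr1 subrr.
Qed.

(** Orthogonality is used with points and frequencies exchanged, as [chi] is symmetric in its two
    arguments. *)
Lemma fourier_inversion n (f : 'I_n -> R[i]) (x : 'I_n) :
  f x = \sum_(a < n) fourier f a * chi R a x.
Proof.
have n0 : n%:R != 0 :> R by rewrite pnatr_eq0 -lt0n (leq_ltn_trans _ (ltn_ord x)).
under eq_bigr => a _ do rewrite -mulrA mulr_suml mulr_sumr.
rewrite exchange_big.
transitivity (\sum_(y < n) (n%:R^-1)%:C * (f y * if x == y then n%:R else 0)).
  rewrite (bigD1 x) //= eqxx big1 => [|y /negPf yx]; last first.
    by rewrite eq_sym yx !mulr0.
  rewrite addr0 mulrC -mulrA -(rmorph_nat (real_complex R)) -rmorphM /=.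
  by rewrite divff // mulr1.
apply: eq_bigr => y _; rewrite -sum_chi_conj !mulr_sumr.
apply: eq_bigr => a _; rewrite (chiC n a x) (chiC n a y).
by rewrite -[in RHS]mulrA [chi R x a * _]mulrC.
Qed.

(** Stated for arbitrary coefficients so as to serve both for a function and for its part off a set
    of frequencies. *)
Lemma l2sq_chi_sum n (c : 'I_n -> R[i]) : (0 < n)%N ->
  l2sq (fun x => \sum_(a < n) c a * chi R a x) = \sum_(a < n) sqnormc (c a).
Proof.
move=> n_gt0; have n0 : n%:R != 0 :> R by rewrite pnatr_eq0 -lt0n.
apply: (@complexI R); rewrite /l2sq rmorphM /= !rmorph_sum /=.
transitivity ((n%:R^-1)%:C * \sum_(a < n) \sum_(b < n)
    (c a * conjc (c b) * if a == b then n%:R else 0)).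
  congr (_ * _).
  under [RHS]eq_bigr => a _ do under eq_bigr => b _ do
    rewrite -sum_chi_conj mulr_sumr.
  under [RHS]eq_bigr => a _ do rewrite exchange_big.
  rewrite [RHS]exchange_big /=; apply: eq_bigr => x _.
  rewrite sqnormcE rmorph_sum mulr_suml /=; apply: eq_bigr => a _.
  rewrite mulr_sumr; apply: eq_bigr => b _.
  by rewrite rmorphM /= mulrACA.
rewrite mulr_sumr; apply: eq_bigr => a _.
rewrite (bigD1 a) //= eqxx big1 => [|b /negPf ba]; last first.
  by rewrite eq_sym ba mulr0.
rewrite addr0 sqnormcE mulrCA -(rmorph_nat (real_complex R)) -rmorphM /=.
by rewrite mulVf // mulr1.
Qed.

Lemma eq_l2sq n (f g : 'I_n -> R[i]) : f =1 g -> l2sq f = l2sq g.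
Proof. by move=> fg; rewrite /l2sq; under eq_bigr => x _ do rewrite fg. Qed.

Lemma parseval n (f : 'I_n -> R[i]) : (0 < n)%N ->
  l2sq f = \sum_(a < n) sqnormc (fourier f a).
Proof.
move=> n0; rewrite -l2sq_chi_sum //; apply: eq_l2sq => x.
exact: fourier_inversion.
Qed.

Lemma l2sq_sub_proj n (f : 'I_n -> R[i]) (G : {set 'I_n}) : (0 < n)%N ->
  l2sq (fun x => f x - Defs.proj f G x) =
  \sum_(a < n | a \notin G) sqnormc (fourier f a).
Proof.
move=> n0; rewrite big_mkcond /=.
pose c a := if a \notin G then fourier f a else 0.
transitivity (\sum_(a < n) sqnormc (c a)); last first.
  by apply: eq_bigr => a _; rewrite /c; case: ifP => // _; rewrite sqnormc0.
rewrite -l2sq_chi_sum //; apply: eq_l2sq => x.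
rewrite [f x]fourier_inversion /Defs.proj [X in _ - X]big_mkcond -sumrB /=.
apply: eq_bigr => a _; rewrite /c; case: (a \in G) => /=.
  by rewrite subrr mul0r.
by rewrite subr0.
Qed.

Lemma sqnormc_fourier_le n (f : 'I_n -> R[i]) (a : 'I_n) :
  sqnormc (fourier f a) <= l2sq f.
Proof.
have n0 : (0 < n)%N by exact: (leq_ltn_trans _ (ltn_ord a)).
rewrite parseval // (bigD1 a) //= lerDl sumr_ge0 // => b _.
exact: sqnormc_ge0.
Qed.

End Fourier.

(** * Extension from Z_n to Z_m and its effect on Fourier coefficients *)

Section Extension.
Variable R : realType.
Implicit Types (n m : nat).

Lemma extendE n m (f : 'I_n -> R[i]) (x : 'I_m) (xn : (x < n)%N) :
  @extend R n m f x = f (Ordinal xn).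
Proof. by rewrite /extend insubT. Qed.

Lemma extend_out n m (f : 'I_n -> R[i]) (x : 'I_m) : (n <= x)%N ->
  @extend R n m f x = 0.
Proof. by move=> nx; rewrite /extend insubF // ltnNge nx. Qed.

Lemma l2sq_extend_le n m (f : 'I_n -> R[i]) : (0 < n)%N -> (0 < m)%N ->
  l2sq (@extend R n m f) <= n%:R / m%:R * l2sq f.
Proof.
move=> n0 m0; rewrite /l2sq.
have -> : n%:R / m%:R * (n%:R^-1 * \sum_(x < n) sqnormc (f x)) =
    m%:R^-1 * \sum_(x < n) sqnormc (f x) :> R.
  by field; rewrite !pnatr_eq0 -!lt0n n0 m0.
apply: ler_wpM2l; first by rewrite invr_ge0.
pose T (i : nat) := sqnormc (oapp f 0 (insub i)).
have -> : \sum_(x < n) sqnormc (f x) = \sum_(0 <= i < n) T i.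
  by rewrite big_mkord; apply: eq_bigr => x _; rewrite /T valK.
have -> : \sum_(x < m) sqnormc (@extend R n m f x) = \sum_(0 <= i < m) T i.
  by rewrite big_mkord.
have T0 i : 0 <= T i by exact: sqnormc_ge0.
have Tout i : (n <= i)%N -> T i = 0.
  by move=> ni; rewrite /T insubF ?sqnormc0 // ltnNge ni.
(* Passing through the range [0, m + n) avoids comparing [n] with [m]: [T] is nonnegative and
   vanishes from [n] on. *)
apply: (@le_trans _ _ (\sum_(0 <= i < m + n) T i)).
  by rewrite (big_cat_nat _ (leq_addr n m)) //= lerDl sumr_ge0.
rewrite (big_cat_nat _ (leq_addl m n)) //= gerDl big_nat_cond big1 //.
by move=> i /andP[/andP[ni _] _]; exact: Tout.
Qed.

Lemma fourier_extend_chi n m (a : 'I_n) (b : 'I_m) :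
  fourier (@extend R n m (chi R a)) b = (m%:R^-1)%:C *
   \sum_(x < minn n m) cis R (2 * pi * ((a%:R * m%:R / n%:R - b%:R) / m%:R)) ^+ x.
Proof.
have n0 : n%:R != 0 :> R by rewrite pnatr_eq0 -lt0n (leq_ltn_trans _ (ltn_ord a)).
have m0 : m%:R != 0 :> R by rewrite pnatr_eq0 -lt0n (leq_ltn_trans _ (ltn_ord b)).
rewrite /fourier; congr (_ * _).
rewrite (big_ord_widen m (fun x => cis R _ ^+ x) (geq_minr n m)).
rewrite [RHS]big_mkcond /=; apply: eq_bigr => x _.
rewrite ltn_min ltn_ord andbT; case: ifP => xn.
  by rewrite extendE; exact: cis_mul_conj.
by rewrite extend_out ?mul0r // leqNgt xn.
Qed.

(* Both b and t lie in [0, m), so of the translates of t by mZ only those by 0, m and -m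
   can realise the distance modulo m. *)
Definition near_freq n m (K : R) (a : 'I_n) : {set 'I_m} :=
  let t := a%:R * m%:R / n%:R in
  [set b : 'I_m | `|b%:R - t| <= K] :|:
  ([set b : 'I_m | `|b%:R - (t - m%:R)| <= K] :|:
   [set b : 'I_m | `|b%:R - (t + m%:R)| <= K]).

Lemma card_near_freq_le n m K (a : 'I_n) : 0 <= K ->
  #|near_freq n m K a|%:R <= 6 * K + 12.
Proof.
move=> K0; set t : R := a%:R * m%:R / n%:R.
have h := leq_trans (leq_card_setU _ _) (leq_add (leqnn _) (leq_card_setU _ _)).
apply: (@le_trans _ _ (_ + (_ + _)%N)%N%:R); first by rewrite ler_nat; exact: h.
rewrite !natrD.
have h1 := card_near_le _ t K m K0.
have h2 := card_near_le _ (t - m%:R) K m K0.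
have h3 := card_near_le _ (t + m%:R) K m K0.
apply: le_trans (lerD h1 (lerD h2 h3)) _; lra.
Qed.

(** With d = t - b, each coefficient is bounded by the geometric sum estimate. Outside [near_freq]
    all three distances exceed [K], so three tails of at most 4 / K remain, with the factor 4 in
    front. *)
Lemma sum_far_fourier_chi_le n m K (a : 'I_n) : 1 <= K ->
  \sum_(b < m | b \notin near_freq n m K a)
    sqnormc (fourier (@extend R n m (chi R a)) b) <= 48 / K.
Proof.
move=> K1; have K0 := lt_le_trans ltr01 K1.
have n0 : 0 < n%:R :> R by rewrite ltr0n (leq_ltn_trans _ (ltn_ord a)).
set t : R := a%:R * m%:R / n%:R.
have -> : 48 / K = 4 * (4 / K + 4 / K + 4 / K) by field; rewrite lt0r_neq0.
apply: le_trans (_ : 4 * (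
   \sum_(b < m | K < `|b%:R - t|) (b%:R - t) ^- 2 +
   \sum_(b < m | K < `|b%:R - (t - m%:R)|) (b%:R - (t - m%:R)) ^- 2 +
   \sum_(b < m | K < `|b%:R - (t + m%:R)|) (b%:R - (t + m%:R)) ^- 2) <= _); last first.
  by apply: ler_wpM2l => //; rewrite !lerD // sum_tail_le.
have mkcond s : \sum_(b < m | K < `|b%:R - s|) (b%:R - s) ^- 2 =
    \sum_(b < m) if K < `|b%:R - s| then (b%:R - s) ^- 2 else 0.
  by rewrite big_mkcond.
rewrite !mkcond -!big_split mulr_sumr big_mkcond /=.
apply: ler_sum => b _; rewrite /near_freq -/t !inE !negb_or -!ltNge.
case: ifP => [/and3P[h1 h2 h3]|_]; last first.
  have h s : 0 <= if K < `|b%:R - s| then (b%:R - s) ^- 2 else 0.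
    by case: ifP => // _; rewrite invr_ge0 sqr_ge0.
  by rewrite mulr_ge0 // !addr_ge0.
rewrite h1 h2 h3 fourier_extend_chi -/t sqnormcM sqnormc_real exprVn.
have -> : (b%:R - t) ^- 2 = (t - b%:R) ^- 2 by rewrite -opprB sqrrN.
have -> : b%:R - (t - m%:R) = m%:R - (t - b%:R) by ring.
have -> : (b%:R - (t + m%:R)) ^- 2 = (m%:R + (t - b%:R)) ^- 2.
  by rewrite -opprB sqrrN; congr (_ ^- 2); ring.
apply: sqnormc_geom_cis_le.
rewrite distrC (lt_trans K0 h1) /= ltr_norml.
have b0 : 0 <= b%:R :> R := ler0n _ _.
have bm : b%:R < m%:R :> R by rewrite ltr_nat.
have m0 := le_lt_trans b0 bm.
have t0 : 0 <= t by rewrite divr_ge0 ?mulr_ge0 ?ler0n.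
have tm : t < m%:R.
  by rewrite /t ltr_pdivrMr // mulrC ltr_pM2l // ltr_nat.
by apply/andP; split; lra.
Qed.

(** Splitting the square costs a factor 2 on both terms. The first gains another 2 from n / m <= 2;
    the second gains |G| from Cauchy-Schwarz, |G| from summing over [a], and 48 / K from the far
    coefficients. *)
Lemma l2sq_extend_sub_proj_le n m (f : 'I_n -> R[i]) (G : {set 'I_n}) K :
  (0 < n)%N -> (0 < m)%N -> n%:R / 2 <= m%:R :> R -> 1 <= K ->
  l2sq (fun x => @extend R n m f x -
    Defs.proj (@extend R n m f) (\bigcup_(a in G) near_freq n m K a) x) <=
  4 * l2sq (fun x => f x - Defs.proj f G x) +
  96 * #|G|%:R ^+ 2 * l2sq f / K.
Proof.
move=> n0 m0 nm K1; have K0 := lt_le_trans ltr01 K1.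
set F := @extend R n m f.
set h := fun x => f x - Defs.proj f G x.
set G' := \bigcup_(a in G) near_freq n m K a.
(* Extension is linear: below [n] this is f = h + projection, and beyond [n] everything is 0. *)
have FE b : fourier F b = fourier (@extend R n m h) b +
    \sum_(a in G) fourier f a * fourier (@extend R n m (chi R a)) b.
  have fourierE (g : 'I_m -> R[i]) : fourier g b =
      (m%:R^-1)%:C * \sum_(x < m) g x * conjc (chi R b x) by [].
  rewrite !fourierE.
  under [\sum_(a in G) _]eq_bigr => a _ do rewrite fourierE mulrCA.
  rewrite -mulr_sumr -mulrDr; congr (_ * _).
  under [\sum_(a in G) _]eq_bigr => a _ do rewrite mulr_sumr.
  rewrite [\sum_(a in G) _]exchange_big -big_split; apply: eq_bigr => x _.
  move: (conjc (chi R b x)) => w /=.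
  under eq_bigr => a _ do rewrite mulrA.
  rewrite -mulr_suml -mulrDl; congr (_ * _).
  have [xn|nx] := ltnP x n; last first.
    rewrite /F !extend_out // big1 ?addr0 // => a _.
    by rewrite extend_out ?mulr0.
  rewrite /F !extendE /h; under eq_bigr => a _ do rewrite extendE.
  by rewrite -/(Defs.proj f G _) subrK.
rewrite l2sq_sub_proj //.
apply: le_trans (_ : \sum_(b < m | b \notin G')
  (2 * sqnormc (fourier (@extend R n m h) b) +
   2 * (#|G|%:R * l2sq f * \sum_(a in G) sqnormc (fourier (@extend R n m (chi R a)) b))) <= _).
  apply: ler_sum => b _; rewrite FE; apply: le_trans (sqnormcD_le _ _ _) _.
  rewrite lerD2l ler_pM2l // -mulrA.
  apply: le_trans (sqnormc_sum_le _ _ _ _) _; apply: ler_wpM2l => //.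
  rewrite mulr_sumr; apply: ler_sum => a _; rewrite sqnormcM.
  by apply: ler_wpM2r; [exact: sqnormc_ge0 | exact: sqnormc_fourier_le].
rewrite big_split /= -!mulr_sumr; apply: lerD.
  have -> : 4 = 2 * 2 :> R by ring.
  rewrite -mulrA ler_pM2l //.
  apply: (@le_trans _ _ (l2sq (@extend R n m h))).
    rewrite [leRHS]parseval // [leLHS]big_mkcond; apply: ler_sum => b _ /=.
    by case: ifP => // _; exact: sqnormc_ge0.
  apply: le_trans (l2sq_extend_le _ _ _ n0 m0) _; apply: ler_wpM2r.
    by rewrite mulr_ge0 ?invr_ge0 // sumr_ge0 // => x _; exact: sqnormc_ge0.
  by rewrite ler_pdivrMr ?ltr0n //; lra.
have f0 : 0 <= l2sq f.
  by rewrite mulr_ge0 ?invr_ge0 // sumr_ge0 // => x _; exact: sqnormc_ge0.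
have -> : 96 * #|G|%:R ^+ 2 * l2sq f / K =
   2 * (#|G|%:R * l2sq f * (#|G|%:R * (48 / K))) by field; rewrite lt0r_neq0.
rewrite ler_pM2l //; apply: ler_wpM2l; first by rewrite mulr_ge0.
rewrite exchange_big /= mulr_natl -sumr_const; apply: ler_sum => a aG.
(* A frequency outside the union lies outside the window of this [a], and the terms are
   nonnegative. *)
apply: le_trans (sum_far_fourier_chi_le n m K a K1).
rewrite big_mkcond [leRHS]big_mkcond; apply: ler_sum => b _ /=.
case: ifP => [bG'|_]; last by case: ifP => // _; exact: sqnormc_ge0.
case: ifP => // /negbFE bN; case/negP: bG'.
by apply/bigcupP; exists a.
Qed.

Lemma card_bigcup_near_freq_le n m K (G : {set 'I_n}) : 0 <= K ->
  #|\bigcup_(a in G) near_freq n m K a|%:R <= #|G|%:R * (6 * K + 12).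
Proof.
move=> K0; rewrite mulr_natl -[leRHS]sumr_const.
apply: (@le_trans _ _ (\sum_(a in G) #|near_freq n m K a|)%N%:R).
  rewrite ler_nat; elim/big_rec2: _ => [|a A k _ IH]; first by rewrite cards0.
  by apply: leq_trans (leq_card_setU _ _) _; rewrite leq_add2l.
rewrite natr_sum; apply: ler_sum => a _; exact: card_near_freq_le.
Qed.

End Extension.

(** * Choice of the window size and of the polynomial for the extended family *)

Theorem theorem1p5 (R : realType) (n m : nat -> nat) (Q : {poly R})
  (f : forall k, 'I_(n k) -> R[i]) :
  (forall k, 0 < n k)%N -> (forall k, 0 < m k)%N ->
  (forall k, (n k)%:R / 2 <= (m k)%:R :> R) ->
  concentrated f ->
  (forall k, l2sq (f k) <= Q.[ln (n k)%:R]) ->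
  concentrated (n := m) (fun k => @extend R (n k) (m k) (f k)).
Proof.
move=> n0 m0 nm [P hP] hQ.
have [C1 [N1 [C10 hP']]] := horner2_bound R P.
have [C2 [N2 [C20 hQ']]] := horner_bound R Q.
(* 32 = 2 * 16: one has 1 + log n <= 2 (1 + log m) and 1 + 16 / eps <= 16 (1 + 1 / eps). *)
have [Y2 Y2E] : exists Y2 : {poly {poly R}},
    forall x y : R, (Y2.[y%:P]).[x] = 32 * ((1 + x) * (1 + y)).
  exists ((32%:P * (1%:P + 'X))%:P * (1%:P + 'X)) => x y.
  by rewrite !(hornerD, hornerM, hornerC, hornerX); ring.
(* [p2] and [K2] are the polynomials whose values at log m and 1 / eps are the numbers [p] and [K]
   below. *)
pose p2 := C1%:P%:P * Y2 ^+ N1.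
pose K2 := 1%:P%:P + 192%:P%:P * (C2%:P%:P * Y2 ^+ N2) * p2 ^+ 2 * Y2.
exists (p2 * (6%:P%:P * K2 + 12%:P%:P)) => k eps eps0.
(* The factor 4 of the extension estimate turns this into less than eps / 4, and the far frequencies
   will add at most eps / 2. *)
have [|G [cG hG]] := hP k (eps / 16); first by rewrite divr_gt0.
set L := ln (m k)%:R; set x := ln (n k)%:R in cG hQ.
have n1 : 1 <= (n k)%:R :> R by rewrite ler1n.
have m1 : 1 <= (m k)%:R :> R by rewrite ler1n.
have x0 : 0 <= x by rewrite ln_ge0.
have L0 : 0 <= L by rewrite ln_ge0.
(* From n <= 2 m and ln 2 <= 1. *)
have xL : x <= L + 1.
  apply: (@le_trans _ _ (ln (2 * (m k)%:R))).
    by rewrite ler_ln ?posrE; have := nm k; lra.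
  rewrite lnM ?posrE ?(lt_le_trans ltr01 m1) // addrC lerD2l.
  by have := @le_ln1Dx R 1; apply; lra.
have e0 : 0 <= eps^-1 by rewrite invr_ge0 ltW.
set Y := 32 * ((1 + L) * (1 + eps^-1)).
have eY : eps^-1 <= Y by rewrite /Y; nra.
have xY : 1 + x <= Y by rewrite /Y; nra.
have Y0 : 0 <= Y := le_trans e0 eY.
have xeY : (1 + x) * (1 + (eps / 16)^-1) <= Y.
  by rewrite invf_div /Y; nra.
pose p := C1 * Y ^+ N1; pose q := C2 * Y ^+ N2.
have p0 : 0 <= p by rewrite mulr_ge0 ?exprn_ge0.
have q0 : 0 <= q by rewrite mulr_ge0 ?exprn_ge0.
have Gp : #|G|%:R <= p.
  apply: (le_trans cG); apply: le_trans (hP' _ _ x0 _) _.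
    by rewrite invr_ge0 divr_ge0 // ltW.
  apply: ler_wpM2l => //; apply: lerXn2r => //.
  by rewrite nnegrE mulr_ge0 ?addr_ge0 // invr_ge0 divr_ge0 // ltW.
have fq : l2sq (f k) <= q.
  apply: (le_trans (hQ k)); apply: le_trans (hQ' _ x0) _.
  by apply: ler_wpM2l => //; apply: lerXn2r; rewrite // nnegrE addr_ge0.
(* Since 1 / eps <= Y, this makes 96 p^2 q / K at most eps / 2; the summand 1 ensures [1 <= K]. *)
pose K := 1 + 192 * q * p ^+ 2 * Y.
have qpY : 0 <= 192 * q * p ^+ 2 * Y.
  by apply: mulr_ge0 => //; do 2!apply: mulr_ge0 => //; exact: exprn_ge0.
have K1 : 1 <= K by rewrite lerDl.
have K0 := lt_le_trans ltr01 K1.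
exists (\bigcup_(a in G) near_freq R (n k) (m k) K a); split.
  apply: le_trans (card_bigcup_near_freq_le _ _ _ _ _ (ltW K0)) _.
  have -> : ((p2 * (6%:P%:P * K2 + 12%:P%:P)).[eps^-1%:P]).[L] =
      p * (6 * K + 12).
    by rewrite /K2 /p2 !(hornerD, hornerM, horner_exp, hornerC) Y2E.
  by apply: ler_wpM2r => //; lra.
apply: le_lt_trans (l2sq_extend_sub_proj_le _ _ _ _ _ _ (n0 k) (m0 k) (nm k) K1) _.
have : 96 * #|G|%:R ^+ 2 * l2sq (f k) / K <= eps / 2.
  have Ge0 : 0 <= #|G|%:R :> R by [].
  have fe0 : 0 <= l2sq (f k).
    by rewrite mulr_ge0 ?invr_ge0 // sumr_ge0 // => z _; exact: sqnormc_ge0.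
  rewrite ler_pdivrMr //.
  apply: (@le_trans _ _ (96 * p ^+ 2 * q)).
    apply: ler_pM => //.
    by rewrite ler_pM2l //; apply: lerXn2r.
  have eY1 : 1 <= eps * Y by rewrite -(mulfV (lt0r_neq0 eps0)) ler_pM2l.
  have pq0 : 0 <= p ^+ 2 * q by rewrite mulr_ge0 ?exprn_ge0.
  have -> : eps / 2 * K = eps / 2 + 96 * (p ^+ 2 * q) * (eps * Y).
    by rewrite /K; field.
  rewrite -mulrA; apply: le_trans (_ : 96 * (p ^+ 2 * q) * (eps * Y) <= _).
    by rewrite ler_peMr // mulr_ge0.
  by rewrite lerDr divr_ge0 // ltW.
lra.
Qed.
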